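(* Let $1\le c\le n-1$ and $-1\le\gamma<0$. For every connected graph $G$ of order $n$ with vertex connectivity $1\le\kappa(G)\le c$, \[{}^0R_{\gamma}(G)\ge c^{\gamma}+(n-c-1)(n-2)^{\gamma}+c(n-1)^{\gamma}.\] If $c=1$ and $\gamma=-1$, equality holds if and only if $G=K_1+(K_{n_1}\cup K_{n_2})$ for some $n_1,n_2\ge 1$ with $n_1+n_2=n-1$; if $c=1$ and $-1<\gamma<0$, or if $c\ge 2$, equality holds if and only if $G=K_c+(K_1\cup K_{n-c-1})$.
   Context: ${}^0R_{\gamma}(G)=\sum_{u\in V(G)} d(u)^{\gamma}$. All graphs are finite, simple and connected. $\kappa(G)$ denotes vertex connectivity (the largest $c$ such that $G$ is $K_{c+1}$ or has at least $c+2$ vertices and no vertex cut of size $c-1$). $G_1\cup G_2$ is the disjoint union, $G_1+G_2$ the join. $K_0$ is the empty graph.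
   Formalization: The equality clause for c=1, γ=-1 is stated only for n≥3: at n=2 the graph K_2 attains equality, but no n_1,n_2≥1 satisfy n_1+n_2=1; for n=2 the term (n-c-1)(n-2)^γ is read as 0. *)

(* Defs.v *)
From mathcomp Require Import all_boot all_order all_algebra.
From mathcomp Require Import all_classical all_reals all_analysis.
Set Implicit Arguments.
Unset Strict Implicit.
Unset Printing Implicit Defensive.
Import Order.TTheory GRing.Theory Num.Theory.

Record sgraph := SGraph {
  vertex :> finType;
  edge : rel vertex;
  edge_sym : symmetric edge;
  edge_irrefl : irreflexive edge
}.

Definition graph_iso (G H : sgraph) : Prop :=
  exists2 f : G -> H, bijective f & forall x y, edge (f x) (f y) = edge x y.

Section CompleteGraph.
Variable n : nat.
Definition complete_edge : rel 'I_n := fun i j => i != j.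
Lemma complete_edge_sym : symmetric complete_edge.
Proof. by move=> i j; rewrite /complete_edge eq_sym. Qed.
Lemma complete_edge_irrefl : irreflexive complete_edge.
Proof. by move=> i; rewrite /complete_edge eqxx. Qed.
Definition complete_graph : sgraph :=
  SGraph complete_edge_sym complete_edge_irrefl.
End CompleteGraph.

Section UnionJoin.
Variables G H : sgraph.

Definition union_edge : rel (G + H)%type := fun x y =>
  match x, y with
  | inl u, inl v => edge u v
  | inr u, inr v => edge u v
  | _, _ => false
  end.
Lemma union_edge_sym : symmetric union_edge.
Proof. by move=> [x|x] [y|y] //=; exact: edge_sym. Qed.
Lemma union_edge_irrefl : irreflexive union_edge.
Proof. by move=> [x|x] /=; exact: edge_irrefl. Qed.
Definition graph_union : sgraph := SGraph union_edge_sym union_edge_irrefl.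

Definition join_edge : rel (G + H)%type := fun x y =>
  match x, y with
  | inl u, inl v => edge u v
  | inr u, inr v => edge u v
  | _, _ => true
  end.
Lemma join_edge_sym : symmetric join_edge.
Proof. by move=> [x|x] [y|y] //=; exact: edge_sym. Qed.
Lemma join_edge_irrefl : irreflexive join_edge.
Proof. by move=> [x|x] /=; exact: edge_irrefl. Qed.
Definition graph_join : sgraph := SGraph join_edge_sym join_edge_irrefl.
End UnionJoin.

Section Invariants.
Variable G : sgraph.

Definition degree (u : G) : nat := #|[set v : G | edge u v]|.

Definition connected_graph : Prop :=
  0 < #|G| /\ forall x y : G, connect (@edge G) x y.

Definition edge_avoiding (S : {set G}) : rel G :=
  fun x y => [&& x \notin S, y \notin S & edge x y].

Definition vertex_cut (S : {set G}) : Prop :=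
  exists x y : G,
    [/\ x \notin S, y \notin S & ~~ connect (edge_avoiding S) x y].

(* "No vertex cut of size c - 1" is written with #|S|.+1 = c, so that it is
   vacuous at c = 0 rather than affected by truncated subtraction. *)
Definition connectivity_cond (c : nat) : Prop :=
  graph_iso G (complete_graph c.+1) \/
  (c + 2 <= #|G| /\ forall S : {set G}, #|S|.+1 = c -> ~ vertex_cut S).

(* connectivity_cond c forces c < #|G|, so the range loses nothing. *)
Definition vertex_connectivity : nat :=
  \max_(c < #|G| | `[< connectivity_cond c >]) c.

Definition general_randic0 (R : realType) (gamma : R) : R :=
  (\sum_(u : G) (degree u)%:R `^ gamma)%R.
End Invariants.

(* Main.v *)
Require Import Defs.
From mathcomp Require Import all_boot all_order all_algebra.
From mathcomp Require Import all_classical all_reals all_analysis.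
From mathcomp Require Import ring lra zify.
Set Implicit Arguments.
Unset Strict Implicit.
Unset Printing Implicit Defensive.
Import Order.TTheory GRing.Theory Num.Theory.
Local Open Scope ring_scope.

(** If [c <= n - 2], a graph of connectivity at most [c] has a vertex cut [S] of
size exactly [c]; splitting the rest into a component [A] and its complement [B]
bounds every degree by the one in [K_c + (K_a U K_b)], with [a + b = n - c].
Since [gamma < 0] and degrees are positive, the index is at least that of this
graph, with equality only for it. In the sizes, the index is
[c (n-1)^gamma + f a + f b] with [f t = t (t + c - 1)^gamma]; writing
[s = t + c - 1], [f = s^(1 + gamma) - (c - 1) s^gamma] is concave, strictly so
unless [c = 1] and [gamma = -1], where it is constant. Hence [f a + f b] is least
at [{a, b} = {1, n - c - 1}]. The case [c = n - 1] fits the same scheme with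
[a = 1] and [b = 0]. *)

(** * Strict tangent inequalities for real powers *)

(** Strictness comes from [ln x < x - 1], multiplied by [r < 0]; at [r * ln x], [expR] lies above
    its tangent at 0. *)
Lemma powR_ge_tangent (R : realType) (r x : R) : r < 0 -> 0 < x -> x != 1 ->
  1 + r * (x - 1) < x `^ r.
Proof.
move=> r0 x0 x1; have u0 : ln x != 0 by rewrite ln_eq0.
have := expR_gt1Dx u0; rewrite lnK // => lnx.
have := expR_ge1Dx (r * ln x); rewrite /powR gt_eqF // => rlnx.
by nra.
Qed.

(* [expR] lies above its tangent at [r * ln x]; compare at [ln x] and [0] with
   weights [r] and [1 - r]. *)
Lemma powR_lt_tangent (R : realType) (r x : R) : 0 < r < 1 -> 0 < x -> x != 1 ->
  x `^ r < 1 + r * (x - 1).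
Proof.
move=> /andP[r0 r1] x0 x1; have u0 : ln x != 0 by rewrite ln_eq0.
rewrite /powR gt_eqF //; set u := ln x in u0 *.
have e0 := expR_gt0 (r * u).
have ru0 : - (r * u) != 0 by rewrite oppr_eq0 mulf_neq0 // gt_eqF.
have qu0 : (1 - r) * u != 0 by rewrite mulf_neq0 // subr_eq0 gt_eqF.
have h1 : (1 - r * u) * expR (r * u) < 1.
  have := expR_gt1Dx ru0.
  by rewrite expRN -(ltr_pM2r e0) mulVf ?gt_eqF.
have h2 : (1 + (1 - r) * u) * expR (r * u) < x.
  have := expR_gt1Dx qu0.
  rewrite -(ltr_pM2r e0) -expRD (_ : (1 - r) * u + r * u = u); last by ring.
  by rewrite lnK.
by nra.
Qed.

Lemma ltr_powR_neg (R : realType) (r x y : R) : r < 0 -> 0 < x -> x < y ->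
  y `^ r < x `^ r.
Proof.
move=> r0 x0 xy; have y0 := lt_trans x0 xy.
by rewrite /powR !gt_eqF // ltr_expR ltr_nM2l // ltr_ln.
Qed.

(** * Strict concavity of the contribution of a clique *)

Section ShiftedPower.
Variables (R : realType) (gamma k : R).
Hypotheses (hgamma : -1 <= gamma < 0) (hk : 0 <= k).
Hypothesis hstrict : -1 < gamma \/ 0 < k.

Let F (s : R) := (s - k) * s `^ gamma.
(** The derivative of [F] at [m]. *)
Let D (m : R) := m `^ gamma * (1 + gamma - k * gamma / m).

(** Dividing by [m ^ gamma] leaves, in [x = s / m], [m] times the concave [x ^ (1 + gamma)] minus
    [k] times the convex [x ^ gamma]; each is compared with its tangent at 1. *)
Lemma shifted_powR_lt_tangent m s : 0 < m -> 0 < s -> s != m ->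
  F s < F m + D m * (s - m).
Proof.
move=> m0 s0 sm; have [g1 g0] := andP hgamma.
pose x := s / m; have x0 : 0 < x by rewrite divr_gt0.
have mN0 : m != 0 by rewrite gt_eqF.
have sE : s = m * x by rewrite /x mulrC divfK.
have x1 : x != 1.
  by apply: contra_neq sm => x1; rewrite sE x1 mulr1.
rewrite /F /D sE powRM ?ltW //.
have mg0 : 0 < m `^ gamma by rewrite powR_gt0.
have -> : (m * x - k) * (m `^ gamma * x `^ gamma) =
   m `^ gamma * (m * (x * x `^ gamma) - k * x `^ gamma) by ring.
have -> : (m - k) * m `^ gamma +
   m `^ gamma * (1 + gamma - k * gamma / m) * (m * x - m) =
   m `^ gamma * (m * (1 + (1 + gamma) * (x - 1)) - k * (1 + gamma * (x - 1))).
  by field.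
rewrite ltr_pM2l //.
have h := powR_ge_tangent g0 x0 x1.
have xpow : x * x `^ gamma = x `^ (1 + gamma).
  by rewrite powRD ?powRr1 ?ltW // (gt_eqF x0) implybT.
(* For [gamma = -1] the power [x ^ (1 + gamma)] is constant, so strictness must come from the term
   weighted by [k]. *)
have [gE|gN] := eqVneq gamma (-1).
  have k0 : 0 < k by case: hstrict => //; rewrite gE ltxx.
  rewrite xpow [in x `^ (1 + _)]gE subrr powRr0.
  have {}h : 0 < k * (x `^ gamma - (1 + gamma * (x - 1))).
    by rewrite mulr_gt0 // subr_gt0.
  by rewrite (_ : 1 + gamma = 0) ?mul0r; lra.
have h' : x * x `^ gamma < 1 + (1 + gamma) * (x - 1).
  rewrite xpow; apply: powR_lt_tangent => //.
  by have : -1 < gamma; [rewrite lt_neqAle eq_sym gN|lra].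
have {}h : 0 <= k * (x `^ gamma - (1 + gamma * (x - 1))).
  by rewrite mulr_ge0 // subr_ge0 ltW.
have {}h' : 0 < m * (1 + (1 + gamma) * (x - 1) - x * x `^ gamma).
  by rewrite mulr_gt0 // subr_gt0.
by lra.
Qed.

(** Tangents at [s] and [t] bound [F u] and [F v]; as [v - t = s - u], the linear terms add up to
    [(D t - D s) * (s - u)], which is at most 0. *)
Lemma shifted_powR_spread u v s t : 0 < u -> u < s -> s <= t ->
  u + v = s + t -> F u + F v < F s + F t.
Proof.
move=> u0 us st uv.
have s0 : 0 < s by lra.
have t0 : 0 < t by lra.
have v0 : 0 < v by lra.
have hu : F u < F s + D s * (u - s).
  by apply: shifted_powR_lt_tangent => //; rewrite lt_eqF.
have hv : F v < F t + D t * (v - t).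
  by apply: shifted_powR_lt_tangent => //; rewrite gt_eqF; lra.
(* For [s < t], adding the tangent inequalities at [s] and [t] gives [(D t - D s) * (t - s) < 0]. *)
have D_le : D t <= D s.
  move: st; rewrite le_eqVlt => /orP[/eqP->//|st].
  have h1 : F s < F t + D t * (s - t).
    by apply: shifted_powR_lt_tangent => //; rewrite lt_eqF.
  have h2 : F t < F s + D s * (t - s).
    by apply: shifted_powR_lt_tangent => //; rewrite gt_eqF.
  by nra.
by nra.
Qed.
End ShiftedPower.

(** * The index as a function of the three sizes *)

(** The index of [K_s + (K_a U K_b)], the bases being the degrees in its three parts. The first term
    sees [a] and [b] only through their sum; [b = 0] gives [K_s + K_a]. *)
Definition cone_randic0 (R : realType) (gamma : R) (s a b : nat) : R :=
  s%:R * (s + a + b).-1%:R `^ gamma +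
  (a%:R * (s + a).-1%:R `^ gamma + b%:R * (s + b).-1%:R `^ gamma).

Lemma cone_randic0_1 (R : realType) (gamma : R) (n c : nat) :
  (1 <= c <= n - 1)%N ->
  c%:R `^ gamma + (n - c - 1)%:R * (n - 2)%:R `^ gamma
    + c%:R * (n - 1)%:R `^ gamma = cone_randic0 gamma c 1 (n - c - 1) :> R.
Proof.
move=> hc; rewrite /cone_randic0 mul1r [LHS]addrC.
have -> : (c + 1 + (n - c - 1)).-1 = (n - 1)%N by lia.
have -> : (c + (n - c - 1)).-1 = (n - 2)%N by lia.
by rewrite addn1.
Qed.

(** Next to a single cut vertex, all degrees in a clique of size [a] are [a], so it contributes
    [a / a = 1] whatever its size. *)
Lemma cone_randic0_inv (R : realType) (a b : nat) : (0 < a)%N -> (0 < b)%N ->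
  cone_randic0 (-1) 1 a b = (a + b)%:R^-1 + 2 :> R.
Proof.
move=> a0 b0; rewrite /cone_randic0 !add1n mul1r !powR_inv1 ?ler0n //=.
by rewrite !mulfV ?pnatr_eq0 -?lt0n.
Qed.

Lemma clique_pair_sum_lt (R : realType) (gamma : R) (k a b : nat) :
  -1 <= gamma < 0 -> -1 < gamma \/ (0 < k)%N -> (1 < a)%N -> (1 < b)%N ->
  k.+1%:R `^ gamma + (a + b).-1%:R * ((a + b).-1 + k)%:R `^ gamma <
  a%:R * (a + k)%:R `^ gamma + b%:R * (b + k)%:R `^ gamma :> R.
Proof.
move=> hg hs.
wlog ab : a b / (a <= b)%N => [th a1 b1|a1 b1].
  have [/th->//|/ltnW/th] := leqP a b.
  by rewrite [ltRHS]addrC (addnC b); apply.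
(* The four points are degrees next to a cut of size [k.+1]; subtracting the shift [k] recovers the
   clique sizes. *)
have h := @shifted_powR_spread R gamma k%:R hg (ler0n _ _) _
  k.+1%:R ((a + b).-1 + k)%:R (a + k)%:R (b + k)%:R.
have E (j : nat) : (j + k)%:R - k%:R = j%:R :> R by rewrite natrD addrK.
have := h; rewrite !E -[k.+1]add1n E mul1r; apply.
- by case: hs => [|k0]; [left|right; rewrite ltr0n].
- by rewrite ltr0n.
- by rewrite ltr_nat; lia.
- by rewrite ler_nat; lia.
- by rewrite -!natrD; congr (_ %:R); lia.
Qed.

Lemma cone_randic0_lt (R : realType) (gamma : R) (s a b : nat) :
  -1 <= gamma < 0 -> (0 < s)%N -> -1 < gamma \/ (1 < s)%N ->
  (1 < a)%N -> (1 < b)%N ->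
  cone_randic0 gamma s 1 (a + b).-1 < cone_randic0 gamma s a b.
Proof.
case: s => // k hg _ hs a1 b1; rewrite /cone_randic0.
have -> : (k.+1 + 1 + (a + b).-1)%N = (k.+1 + a + b)%N by lia.
rewrite ltrD2l addn1 mul1r !addSn /= !(addnC k).
exact: clique_pair_sum_lt.
Qed.

Lemma big_option_bool (V : Type) (idx : V) (op : Monoid.com_law idx)
    (F : option bool -> V) :
  \big[op/idx]_x F x = op (F None) (op (F (Some true)) (F (Some false))).
Proof.
rewrite (bigD1 None) // (bigD1 (Some true)) // (bigD1 (Some false)) //=.
by rewrite big1 ?Monoid.mulm1 // => -[[]|].
Qed.

(** * Counting by colour classes *)

Section ColourClasses.
Variables (T C : finType) (k : T -> C).

Definition class_size (x : C) : nat := #|[set u | k u == x]|.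

Lemma sum_colour (V : nmodType) (f : C -> V) :
  \sum_u f (k u) = \sum_x f x *+ class_size x.
Proof.
rewrite (partition_big k xpredT) //=; apply: eq_bigr => x _.
rewrite (eq_bigr (fun=> f x)) => [|u /eqP->//].
by rewrite -sumr_const; apply: eq_bigl => u; rewrite inE.
Qed.

Lemma card_colour (P : pred C) :
  #|[set u | P (k u)]| = (\sum_x P x * class_size x)%N.
Proof.
rewrite -sum1_card (partition_big k xpredT) //=; apply: eq_bigr => x _.
rewrite /class_size -sum1_card big_distrr /= big_mkcond [RHS]big_mkcond /=.
by apply: eq_bigr => u _; rewrite !inE; case: eqVneq => [->|]; case: P.
Qed.
End ColourClasses.

(** Each vertex goes to the entry at its own position in the list of the class of the same
    colour. *)
Lemma colour_bijection (T U C : finType) (k : T -> C) (l : U -> C) :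
  class_size k =1 class_size l ->
  exists2 f : T -> U, bijective f & forall u, l (f u) = k u.
Proof.
move=> kl; pose E x := enum [set v | l v == x].
pose e x := enum [set v | k v == x].
have e_in u : u \in e (k u) by rewrite mem_enum inE.
have idx u : (index u (e (k u)) < size (E (k u)))%N.
  rewrite -cardE; have := kl (k u); rewrite /class_size => <-.
  by rewrite cardE index_mem.
(* [tnth] avoids a default element of [U], which may be empty. *)
pose f u := tnth (in_tuple (E (k u))) (Ordinal (idx u)).
have fE u y : f u = nth y (E (k u)) (index u (e (k u))) by rewrite /f (tnth_nth y).
have lf u : l (f u) = k u.
  by have := mem_tnth (Ordinal (idx u)) (in_tuple (E (k u))); rewrite mem_enum inE => /eqP.
exists f => //; apply: inj_card_bij => [u v fuv|].
  have kuv : k u = k v by rewrite -!lf fuv.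
  move/eqP: fuv; rewrite (fE u (f u)) (fE v (f u)) -kuv nth_uniq ?enum_uniq //; last first.
    by rewrite kuv.
  by move=> /eqP/index_inj; apply; rewrite // kuv.
have card_sum (W : finType) (h : W -> C) : #|W| = (\sum_x class_size h x)%N.
  rewrite -cardsT; have := card_colour h predT.
  rewrite (eq_bigr (class_size h)) => [<-|x _]; last by rewrite mul1n.
  by apply: eq_card => u; rewrite !inE.
by rewrite (card_sum _ k) (card_sum _ l) (eq_bigr _ (fun x _ => kl x)).
Qed.

(* Colours: [None] for the cut, [Some true] and [Some false] for its two sides. *)
Definition colour_compat (x y : option bool) : bool :=
  match x, y with Some i, Some j => i == j | _, _ => true end.

(** * Degrees under a colouring of cut and sides *)

Section Colouring.
Variables (G : sgraph) (k : G -> option bool).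

(** Classes may be empty, so complete graphs, which have no cut, are covered too. *)
Definition cut_colouring : Prop :=
  forall u v : G, edge u v -> colour_compat (k u) (k v).

Definition full_colouring : Prop :=
  forall u v : G, edge u v = (u != v) && colour_compat (k u) (k v).

(** The degree reached once every edge that the colouring allows is present. *)
Definition full_degree (x : option bool) : nat :=
  match x with
  | None => (class_size k None + class_size k (Some true)
              + class_size k (Some false)).-1
  | Some i => (class_size k None + class_size k (Some i)).-1
  end.

Lemma card_class_size :
  #|G| = (class_size k None + class_size k (Some true)
           + class_size k (Some false))%N.
Proof.
rewrite -cardsT -addnA; have := card_colour k predT.
rewrite big_option_bool /= !mul1n => <-.
by apply: eq_card => u; rewrite !inE.
Qed.

Lemma card_full_neighbours (u : G) :
  #|[set v | (u != v) && colour_compat (k u) (k v)]| = full_degree (k u).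
Proof.
transitivity (#|[set v | colour_compat (k u) (k v)]|).-1.
  rewrite [in RHS](cardsD1 u) inE; have -> : colour_compat (k u) (k u).
    by case: (k u) => //= i.
  by apply: eq_card => v; rewrite !inE eq_sym.
rewrite (card_colour k (colour_compat (k u))) big_option_bool.
by case: (k u) => [[]|] /=; rewrite !(mul0n, mul1n) ?addn0 ?add0n ?addnA.
Qed.

Lemma degree_full u : full_colouring -> degree u = full_degree (k u).
Proof.
move=> kP; rewrite -card_full_neighbours /degree.
by apply: eq_card => v; rewrite !inE kP.
Qed.

Lemma edge_neq u v : edge u v -> u != v :> G.
Proof. by apply: contraTneq => ->; rewrite edge_irrefl. Qed.

Lemma cut_neighbours_subset u : cut_colouring ->
  [set v | edge u v] \subset [set v | (u != v) && colour_compat (k u) (k v)].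
Proof.
by move=> kP; apply/fintype.subsetP => v; rewrite !inE => uv; rewrite edge_neq //= kP.
Qed.

Lemma degree_cut_le u : cut_colouring -> (degree u <= full_degree (k u))%N.
Proof.
by move=> kP; rewrite -card_full_neighbours subset_leq_card ?cut_neighbours_subset.
Qed.

(** Each neighbourhood lies in the set of allowed neighbours; equal cardinalities make the two sets
    equal. *)
Lemma full_of_degree : cut_colouring ->
  (forall u, degree u = full_degree (k u)) -> full_colouring.
Proof.
move=> kP dk u v; have := subset_leqif_card (cut_neighbours_subset u kP).
case=> _; rewrite card_full_neighbours -dk eqxx => /esym/idP/fintype.subsetP/(_ v) sub.
move: sub; rewrite !inE => uv; apply/idP/idP => // uv'.
by rewrite edge_neq //= kP.
Qed.

Lemma sum_full_degree (R : realType) (gamma : R) :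
  \sum_(u : G) (full_degree (k u))%:R `^ gamma =
  cone_randic0 gamma (class_size k None) (class_size k (Some true))
    (class_size k (Some false)).
Proof.
rewrite (sum_colour k (fun x => (full_degree x)%:R `^ gamma)) big_option_bool.
by rewrite /cone_randic0 !mulr_natl.
Qed.
End Colouring.

(** * Isomorphism with the extremal graphs *)

Lemma full_colouring_iso (G H : sgraph) (k : G -> option bool)
    (l : H -> option bool) :
  full_colouring k -> full_colouring l -> class_size k =1 class_size l ->
  graph_iso G H.
Proof.
move=> kP lP kl; have [f fb lf] := colour_bijection kl.
by exists f => // x y; rewrite lP kP !lf (inj_eq (bij_inj fb)).
Qed.

Notation cone s a b := (graph_join (complete_graph s)
  (graph_union (complete_graph a) (complete_graph b))).

Definition cone_colour (s a b : nat) (x : cone s a b) : option bool :=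
  match x with inl _ => None | inr (inl _) => Some true
  | inr (inr _) => Some false end.

Lemma cone_colour_full s a b : full_colouring (@cone_colour s a b).
Proof.
move=> [u|[u|u]] [v|[v|v]] //=; rewrite ?andbT ?andbF //.
Qed.

Lemma cone_class_size s a b x : class_size (@cone_colour s a b) x =
  match x with None => s | Some true => a | Some false => b end.
Proof.
rewrite /class_size.
case: x => [[]|].
- rewrite -[RHS]card_ord -(card_imset _ (f := fun i : 'I_a =>
    (inr (inl i) : cone s a b))) => [|i j [] //].
  apply: eq_card => -[u|[u|u]]; rewrite inE; apply/esym; rewrite ?imset_f ?inE //;
  by apply/imsetP => -[].
- rewrite -[RHS]card_ord -(card_imset _ (f := fun i : 'I_b =>
    (inr (inr i) : cone s a b))) => [|i j [] //].
  apply: eq_card => -[u|[u|u]]; rewrite inE; apply/esym; rewrite ?imset_f ?inE //;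
  by apply/imsetP => -[].
- rewrite -[RHS]card_ord -(card_imset _ (f := fun i : 'I_s =>
    (inl i : cone s a b))) => [|i j [] //].
  apply: eq_card => -[u|[u|u]]; rewrite inE; apply/esym; rewrite ?imset_f ?inE //;
  by apply/imsetP => -[].
Qed.

(** Turns the equality cases into statements about class sizes: the standard colouring is pulled
    back along an isomorphism, and conversely a colour-preserving bijection respects edges. *)
Lemma cone_isoP (G : sgraph) s a b : graph_iso G (cone s a b) <->
  exists k : G -> option bool,
    [/\ full_colouring k, class_size k None = s,
        class_size k (Some true) = a & class_size k (Some false) = b].
Proof.
split=> [[f fb fE]|[k [kP ks ka kb]]]; last first.
  apply: (full_colouring_iso kP (@cone_colour_full s a b)) => -[[]|];
  by rewrite cone_class_size.
have ks x : class_size (@cone_colour s a b \o f) x = class_size (@cone_colour s a b) x.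
  rewrite /class_size -(on_card_preimset (onW_bij _ fb)).
  by apply: eq_card => u; rewrite !inE.
exists (@cone_colour s a b \o f); rewrite !ks !cone_class_size; split => // u v.
by rewrite -fE cone_colour_full (inj_eq (bij_inj fb)).
Qed.

(** * Cuts obtained from bounded connectivity *)

Lemma complete_iso (G : sgraph) n : #|G| = n ->
  (forall u v : G, u != v -> edge u v) -> graph_iso G (complete_graph n).
Proof.
move=> cG eG; exists (fun u => cast_ord cG (enum_rank u)) => [|u v].
  by apply: inj_card_bij; rewrite ?card_ord ?cG // => u v /cast_ord_inj/enum_rank_inj.
rewrite /= /complete_edge (inj_eq (@cast_ord_inj _ _ cG)) (inj_eq enum_rank_inj).
by apply/idP/idP; [exact: eG|exact: edge_neq].
Qed.

Lemma nonadjacent_cut (G : sgraph) (u v : G) : u != v -> ~~ edge u v ->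
  vertex_cut (~: [set u; v]).
Proof.
move=> uv nuv; exists u, v; split; rewrite ?inE ?eqxx ?orbT //.
apply/negP => /connectP[[|w p] /= pw vE]; first by rewrite vE eqxx in uv.
move: pw; rewrite /edge_avoiding !inE eqxx negbK /= => /andP[/andP[+ uw] _].
rewrite negbK; case/orP=> /eqP wE; rewrite wE in uw.
  by rewrite edge_irrefl in uw.
by rewrite uw in nuv.
Qed.

(** Without such a cut, [connectivity_cond G c.+1] would hold and push the connectivity above
    [c]. *)
Lemma exists_vertex_cut (G : sgraph) c : (c.+2 <= #|G|)%N ->
  (vertex_connectivity G <= c)%N -> exists2 S : {set G}, #|S| = c & vertex_cut S.
Proof.
move=> cG kG; apply: contrapT => nS.
suff /asboolP cond : connectivity_cond G c.+1.
  have : (c.+1 <= vertex_connectivity G)%N.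
    exact: (@bigop.bigmax_sup _ (Ordinal cG)).
  by rewrite ltnNge kG.
have [cG'|cG'] := leqP c.+3 #|G|.
  by right; split=> [|S [Sc] Scut]; [rewrite addn2|apply: nS; exists S].
(* Here the order is too small for the second alternative, so [G] must be shown complete: the
   complement of a nonadjacent pair would be a cut of size [c]. *)
have {cG'}cG : #|G| = c.+2 by lia.
left; apply: complete_iso => // u v uv; apply: contrapT => /negP nuv.
apply: nS; exists (~: [set u; v]); last exact: nonadjacent_cut.
by have := cardsC [set u; v]; rewrite cards2 uv cG; lia.
Qed.

Lemma cut_colouring_of_cut (G : sgraph) (S : {set G}) : vertex_cut S ->
  exists k : G -> option bool,
    [/\ cut_colouring k, class_size k None = #|S|,
        (0 < class_size k (Some true))%N & (0 < class_size k (Some false))%N].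
Proof.
move=> [x [y [xS yS xy]]]; pose e := edge_avoiding S.
have e_sym : connect_sym e.
  by apply: sym_connect_sym => u v; rewrite /e /edge_avoiding edge_sym andbCA.
(* One side is the component of [x] outside [S]; the other may gather several components, among them
   that of [y]. *)
pose k u := if u \in S then None else Some (connect e x u).
exists k; split.
- move=> u v uv; rewrite /k; case: ifPn => // uS; case: ifPn => // vS /=.
  have uv' : connect e u v by apply: connect1; rewrite /e /edge_avoiding uS vS.
  apply/eqP; apply/idP/idP => h; first exact: connect_trans uv'.
  by apply: connect_trans h _; rewrite e_sym.
- by apply: eq_card => u; rewrite inE /k; case: ifP.
- by apply/card_gt0P; exists x; rewrite inE /k (negPf xS) connect0.
- by apply/card_gt0P; exists y; rewrite inE /k (negPf yS) (negPf xy).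
Qed.

Lemma cut_colouring_swap (G : sgraph) (k : G -> option bool) :
  cut_colouring k -> exists k' : G -> option bool,
    cut_colouring k' /\ forall x, class_size k' x = class_size k (omap negb x).
Proof.
move=> kP; exists (omap negb \o k); split=> [u v /kP|x] /=.
  by case: (k u) (k v) => [[]|] [[]|].
apply: eq_card => u; rewrite !inE /=.
by case: (k u) x => [[]|] [[]|].
Qed.

(** Separates the sizes that are already extremal from those where both sides can still be
    unbalanced further. *)
Lemma connectivity_colouring (G : sgraph) c :
  (c < #|G|)%N -> (vertex_connectivity G <= c)%N ->
  exists k : G -> option bool,
    [/\ cut_colouring k, class_size k None = c &
        class_size k (Some true) = 1%N \/
        (1 < class_size k (Some true))%N /\ (1 < class_size k (Some false))%N].
Proof.
move=> cG kG; have [cG'|cG'] := leqP c.+2 #|G|; last first.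
  have {cG'}cG : #|G| = c.+1 by lia.
  have /card_gt0P[x _] : (0 < #|G|)%N by lia.
  (* With order [c + 1], a single vertex forms one side, the other side is empty and all pairs are
     compatible. *)
  pose k u := if u == x then Some true else None.
  have k1 : class_size k (Some true) = 1%N.
    rewrite -(cards1 x); apply: eq_card => u; rewrite !inE /k.
    by case: ifP.
  exists k; split; [| |by left].
    by move=> u v _; rewrite /k; case: ifP; case: ifP.
  have k0 : class_size k (Some false) = 0%N.
    by apply: eq_card0 => u; rewrite !inE /k; case: ifP.
  by have := card_class_size k; rewrite k1 k0 cG; lia.
have [S Sc /cut_colouring_of_cut[k [kP kS kt kf]]] := exists_vertex_cut cG' kG.
have [kf1|kfN1] := eqVneq (class_size k (Some false)) 1%N.
  have [k' [k'P k'E]] := cut_colouring_swap kP.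
  by exists k'; rewrite !k'E /= kS kf1; split=> //; left.
exists k; rewrite kS; split=> //; have [->|kt1] := eqVneq (class_size k (Some true)) 1%N.
  by left.
by right; split; lia.
Qed.

(** Keeps degrees away from 0, where [powR] with a negative exponent takes the value 0 and
    monotonicity fails. *)
Lemma connected_degree_gt0 (G : sgraph) (u : G) :
  connected_graph G -> (1 < #|G|)%N -> (0 < degree u)%N.
Proof.
move=> [_ Gc] G1; have : (0 < #|[set~ u]|)%N.
  by have := cardsC [set u]; rewrite cards1; lia.
case/card_gt0P=> v; rewrite !inE => vu.
have /connectP[[|w p] /= pw vE] := Gc u v; first by rewrite vE eqxx in vu.
by apply/card_gt0P; exists w; rewrite inE; case/andP: pw.
Qed.

(** * Comparing the index with that of the full graph *)

Section CutColouringBound.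
Variables (R : realType) (gamma : R) (G : sgraph) (k : G -> option bool).
Hypotheses (gamma_lt0 : gamma < 0) (Gconn : connected_graph G).
Hypotheses (G_gt1 : (1 < #|G|)%N) (kP : cut_colouring k).

Let dpow (d : nat) : R := d%:R `^ gamma.

Let dpow_lt (d e : nat) : (0 < d)%N -> (d < e)%N -> dpow e < dpow d.
Proof. by move=> d0 de; apply: ltr_powR_neg; rewrite ?ltr0n ?ltr_nat. Qed.

Let dpow_ge u : dpow (full_degree k (k u)) <= dpow (degree u).
Proof.
have := degree_cut_le u kP; rewrite leq_eqVlt => /orP[/eqP->//|du].
by apply/ltW/dpow_lt => //; exact: connected_degree_gt0.
Qed.

Lemma randic0_ge_cone :
  cone_randic0 gamma (class_size k None) (class_size k (Some true))
    (class_size k (Some false)) <= general_randic0 G gamma.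
Proof. by rewrite -sum_full_degree; apply: ler_sum => u _; exact: dpow_ge. Qed.

(** The termwise differences are nonnegative and sum to 0, so each vanishes; strict monotonicity
    then forces every degree to be full. *)
Lemma randic0_eq_cone :
  general_randic0 G gamma =
  cone_randic0 gamma (class_size k None) (class_size k (Some true))
    (class_size k (Some false)) -> full_colouring k.
Proof.
rewrite -sum_full_degree => /eqP; rewrite -subr_eq0 -sumrB => /eqP s0.
apply: full_of_degree => // u; have := degree_cut_le u kP.
rewrite leq_eqVlt => /orP[/eqP//|du].
have ge0 v : true -> 0 <= dpow (degree v) - dpow (full_degree k (k v)).
  by move=> _; rewrite subr_ge0 dpow_ge.
have /eqP := psumr_eq0P ge0 s0 (i := u) isT.
rewrite subr_eq0 gt_eqF //; apply: dpow_lt => //.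
exact: connected_degree_gt0.
Qed.
End CutColouringBound.

Lemma randic0_full (R : realType) (gamma : R) (G : sgraph) (k : G -> option bool) :
  full_colouring k -> general_randic0 G gamma =
  cone_randic0 gamma (class_size k None) (class_size k (Some true))
    (class_size k (Some false)).
Proof.
move=> kP; rewrite -sum_full_degree; apply: eq_bigr => u _.
by rewrite (degree_full u kP).
Qed.

(** * The bound and its equality cases *)

Theorem theorem3p7 (R : realType) (n c : nat) (gamma : R) (G : sgraph)
    (hc : (1 <= c <= n - 1)%N)
    (hgamma : -1 <= gamma < 0)
    (hn : #|G| = n)
    (hconn : connected_graph G)
    (hkappa : (1 <= vertex_connectivity G <= c)%N) :
  let bound : R :=
    c%:R `^ gamma + (n - c - 1)%:R * (n - 2)%:R `^ gamma
      + c%:R * (n - 1)%:R `^ gamma in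
  [/\ bound <= general_randic0 G gamma,
      (c = 1%N /\ gamma = -1 -> (2 < n)%N ->
        (general_randic0 G gamma = bound <->
         exists n1 n2 : nat,
           [/\ (1 <= n1)%N, (1 <= n2)%N, (n1 + n2 = n - 1)%N &
               graph_iso G
                 (graph_join (complete_graph 1)
                    (graph_union (complete_graph n1) (complete_graph n2)))]))
    & ((c = 1%N /\ -1 < gamma < 0) \/ (2 <= c)%N ->
        (general_randic0 G gamma = bound <->
         graph_iso G
           (graph_join (complete_graph c)
              (graph_union (complete_graph 1) (complete_graph (n - c - 1))))))].
Proof.
move=> bound; have [c0 cn] := andP hc; have [_ kc] := andP hkappa.
have [g1 g0] := andP hgamma.
have boundE : bound = cone_randic0 gamma c 1 (n - c - 1) by exact: cone_randic0_1.
have G1 : (1 < #|G|)%N by lia.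
have cG : (c < #|G|)%N by lia.
have [k [kP ks kab]] := connectivity_colouring cG kc.
have ge_cone := randic0_ge_cone g0 hconn G1 kP.
have full_of_eq := @randic0_eq_cone R _ _ _ g0 hconn G1 kP.
have nE := card_class_size k; rewrite hn ks in nE.
have [a ka] : exists a, class_size k (Some true) = a by eexists.
have [b kb] : exists b, class_size k (Some false) = b by eexists.
rewrite ks ka kb in ge_cone full_of_eq; rewrite ka kb in nE kab.
have bE : (n - c - 1)%N = (a + b).-1 by lia.
rewrite bE in boundE.
have inv_case : c = 1%N -> gamma = -1 -> (0 < a)%N -> (0 < b)%N ->
    bound = cone_randic0 gamma c a b.
  move=> c1 gE a0 b0; rewrite boundE c1 gE !cone_randic0_inv //; last by lia.
  by congr (_%:R^-1 + _); lia.
have strict_case : (1 < a)%N /\ (1 < b)%N -> -1 < gamma \/ (1 < c)%N ->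
    bound < cone_randic0 gamma c a b.
  by move=> [a1 b1] ?; rewrite boundE cone_randic0_lt.
have le_cone : bound <= cone_randic0 gamma c a b.
  case: kab => [a1|ab]; first by rewrite boundE a1 add1n.
  have [c1|c1] := leqP 2 c; first by apply/ltW/strict_case => //; right.
  have [gE|gN] := eqVneq gamma (-1).
    by rewrite -inv_case //; lia.
  by apply/ltW/strict_case => //; left; rewrite lt_neqAle eq_sym gN.
(* The cone value lies between the bound and the index, so equality of these two forces equality
   with it. *)
have full_of_bound : general_randic0 G gamma = bound -> full_colouring k.
  move=> h; apply: full_of_eq; apply/le_anti.
  by rewrite ge_cone {1}h le_cone.
split; first exact: le_trans ge_cone.
- move=> [c1 gE] n2; split=> [h|[n1 [n2' [n10 n20 n12 /cone_isoP[k' [k'P k's k'a k'b]]]]]].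
    (* If [a = 1], then [b = n - 2], which is positive because [n > 2]. *)
    exists a, b; split; try lia.
    by apply/cone_isoP; exists k; rewrite ks c1 ka kb; split=> //; exact: full_of_bound.
  rewrite (randic0_full gamma k'P) k's k'a k'b boundE c1 gE !cone_randic0_inv //; try lia.
  by congr (_%:R^-1 + _); lia.
- move=> hs; have hs' : -1 < gamma \/ (1 < c)%N.
    by case: hs => [[_ /andP[]]|]; [left|right].
  split=> [h|/cone_isoP[k' [k'P k's k'a k'b]]]; last first.
    by rewrite (randic0_full gamma k'P) k's k'a k'b boundE bE.
  (* Two sides of size at least 2 would put the index strictly above the bound. *)
  case: kab => [a1|ab].
    apply/cone_isoP; exists k; rewrite ks ka kb; split=> //; last by lia.
    exact: full_of_bound.
  by have := lt_le_trans (strict_case ab hs') ge_cone; rewrite h ltxx.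
Qed.
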